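(* Let $T$ be a tree with $n$ vertices. Then $$\mathrm{Pm}(P_4\times T)=\prod\left(1+3\alpha^2+\alpha^4\right),$$ where the product ranges over all non-negative eigenvalues $\alpha$ of $T$, each repeated according to its multiplicity.
   Context: For a graph $G$, $\mathrm{Pm}(G)$ denotes the number of perfect matchings of $G$. $P_4$ is the path with 4 vertices, and $G\times H$ denotes the Cartesian product of graphs $G$ and $H$. The eigenvalues of a graph are the eigenvalues of its (0,1) adjacency matrix. *)

(* Defs.v *)
From HB Require Import structures.
From mathcomp Require Import all_boot all_order all_algebra.

Set Implicit Arguments.
Unset Strict Implicit.
Unset Printing Implicit Defensive.

Import Order.TTheory GRing.Theory Num.Theory.

Local Open Scope ring_scope.

Record sgraph := SGraph {
  vertex :> finType;
  adj : rel vertex;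
  adj_sym : symmetric adj;
  adj_irr : irreflexive adj }.

Definition connected (G : sgraph) : Prop :=
  (0 < #|G|)%N /\ forall x y : G, connect (@adj G) x y.

(* The size bound excludes closed walks [:: x; y] back and forth along an edge. *)
Definition acyclic (G : sgraph) : Prop :=
  forall c : seq G, (2 < size c)%N -> ~ ucycle (@adj G) c.

Definition is_tree (G : sgraph) : Prop := connected G /\ acyclic G.

Definition edges (G : sgraph) : {set {set G}} :=
  [set [set p.1; p.2] | p : G * G & adj p.1 p.2].

Definition perfect_matching (G : sgraph) (M : {set {set G}}) : bool :=
  (M \subset edges G) && [forall v : G, #|[set E in M | v \in E]| == 1%N].

Definition Pm (G : sgraph) : nat :=
  #|[set M : {set {set G}} | perfect_matching M]|.

Definition path_adj (n : nat) : rel 'I_n :=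
  fun i j => (i.+1 == j :> nat) || (j.+1 == i :> nat).

Fact path_adj_sym n : symmetric (@path_adj n).
Proof. by move=> i j; rewrite /path_adj orbC. Qed.

Fact path_adj_irr n : irreflexive (@path_adj n).
Proof. by move=> i; rewrite /path_adj orbb eqn_leq ltnn. Qed.

(* The path with n vertices (not n edges). *)
Definition path_graph (n : nat) : sgraph :=
  SGraph (@path_adj_sym n) (@path_adj_irr n).

Definition cart_adj (G H : sgraph) : rel (G * H) :=
  fun u v => ((u.1 == v.1) && adj u.2 v.2) || (adj u.1 v.1 && (u.2 == v.2)).

Fact cart_adj_sym G H : symmetric (@cart_adj G H).
Proof.
move=> u v; rewrite /cart_adj.
by rewrite (eq_sym u.1) (eq_sym u.2) (adj_sym u.1) (adj_sym u.2).
Qed.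

Fact cart_adj_irr G H : irreflexive (@cart_adj G H).
Proof. by move=> u; rewrite /cart_adj !adj_irr andbF. Qed.

Definition cart_graph (G H : sgraph) : sgraph :=
  SGraph (@cart_adj_sym G H) (@cart_adj_irr G H).

Definition adj_mx (C : nzRingType) (G : sgraph) : 'M[C]_#|G| :=
  \matrix_(i, j) (adj (enum_val i) (enum_val j))%:R.

(* All roots of the characteristic polynomial of the adjacency matrix, each
   listed as often as its multiplicity; the order is irrelevant.  As C is
   only partially ordered, 0 <= a holds exactly when a is real and non-negative. *)
Definition eigenvalues (C : numClosedFieldType) (G : sgraph) : seq C :=
  sval (closed_field_poly_normal (char_poly (adj_mx C G))).

(* Main.v *)
(* Cut a perfect matching of G x H into the set S v of positions of the column
   over v that are matched along H, one matching of H per row, and one matching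
   of G on the rest of each column; this writes Pm(G x H) as a sum over S.  When H
   is a forest, a leaf l hanging at v can be summed out, and its weight is absorbed
   in the weight of v.  For G = P_4 the weights that occur stay in a family with
   four parameters (a, b, a', b'), on which absorbing a leaf acts as two
   independent copies of (a, b) |-> (a_l a + b_l b, a_l b).  This is also the
   effect of eliminating a leaf from det (D + iA), so Pm(P_4 x T) is the product
   of det (phi + iA) and det (phi^-1 + iA), where phi is the golden ratio.  The
   spectrum of T is real and, T being bipartite, symmetric; the eigenvalues z
   and -z together contribute (phi^2 + z^2)(phi^-2 + z^2) = 1 + 3 z^2 + z^4. *)

Require Import Defs.
From HB Require Import structures.
From mathcomp Require Import all_boot all_order all_algebra.
From mathcomp Require Import ring.

Set Implicit Arguments.
Unset Strict Implicit.
Unset Printing Implicit Defensive.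

Import Order.TTheory GRing.Theory Num.Theory.

Local Open Scope ring_scope.

(** * Perfect matchings as involutions *)

(* A perfect matching of the subgraph induced on U is encoded as the involution
   exchanging matched vertices, extended by the identity outside U. *)
Definition matching_on (G : sgraph) (U : {set G}) (s : {ffun G -> G}) : bool :=
  [forall x, (s (s x) == x) && (if x \in U then adj x (s x) else s x == x)].

Definition nmatch (G : sgraph) (U : {set G}) : nat :=
  #|[set s : {ffun G -> G} | matching_on U s]|.

Lemma matching_onP (G : sgraph) (U : {set G}) (s : {ffun G -> G}) :
  reflect [/\ involutive s, {in U, forall x, adj x (s x)} &
             forall x, x \notin U -> s x = x]
          (matching_on U s).
Proof.
apply: (iffP forallP) => [h|[hi hU hN] x].
  split=> x; first by case/andP: (h x) => /eqP.
    by move=> xU; move: (h x); rewrite xU => /andP[].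
  by move=> xU; move: (h x); rewrite (negPf xU) => /andP[_ /eqP].
by rewrite hi eqxx /=; case: ifPn => [/hU|/hN->].
Qed.

Lemma adj_neq (G : sgraph) (x y : G) : adj x y -> x != y.
Proof. by apply: contraTneq => ->; rewrite adj_irr. Qed.

(** An involution [s] is recovered from its set of pairs {x, s x}, because the pair through x is the
    only one containing x. *)
Lemma Pm_nmatch (G : sgraph) : Pm G = nmatch [set: G].
Proof.
pose pairs (s : {ffun G -> G}) := [set [set x; s x] | x : G].
have in_pairs (s : {ffun G -> G}) E x : involutive s ->
    (E \in pairs s) && (x \in E) = (E == [set x; s x]).
  move=> si; apply/andP/eqP => [[/imsetP[y _ ->]]|->]; last first.
    by rewrite set21; split=> //; apply/imsetP; exists x.
  by rewrite !inE => /orP[] /eqP-> //; rewrite si setUC.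
have pairs_inj : {in [set s | matching_on [set: G] s] &, injective pairs}.
  move=> s t; rewrite !inE => /matching_onP[si sa _] /matching_onP[ti ta _] est.
  apply/ffunP => x; have := in_pairs t [set x; s x] x ti.
  rewrite -est in_pairs // eqxx => /esym/eqP e.
  have: s x \in [set x; t x] by rewrite -e set22.
  rewrite !inE eq_sym (negPf (adj_neq (sa x _))) ?inE //=.
  by move/eqP.
rewrite /nmatch -(card_in_imset pairs_inj) /Pm; congr #|pred_of_set _|.
apply/setP => M; rewrite inE; apply/andP/imsetP => [[/subsetP ME /forallP Mu]|[s]].
  have uM x y z : adj x y -> adj x z -> [set x; y] \in M -> [set x; z] \in M -> y = z.
    move=> xy xz yM zM; case/cards1P: (Mu x) => E hE.
    have: [set x; y] \in [set E] by rewrite -hE inE yM set21.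
    have: [set x; z] \in [set E] by rewrite -hE inE zM set21.
    rewrite !inE => /eqP <- /eqP e.
    have: y \in [set x; z] by rewrite -e set22.
    by rewrite !inE eq_sym (negPf (adj_neq xy)) /= => /eqP.
  (* The default [x] is never returned: by [Mu], each vertex lies in some edge of [M]. *)
  pose s := [ffun x => odflt x [pick y | adj x y && ([set x; y] \in M)]].
  have sP x : adj x (s x) && ([set x; s x] \in M).
    rewrite ffunE; case: pickP => //= none.
    case/cards1P: (Mu x) => E hE.
    have: E \in [set E] by rewrite inE.
    rewrite -hE inE => /andP[EM]; have /imsetP[[p q]] := ME _ EM.
    rewrite inE /= => pq eE; rewrite eE !inE => /orP[]/eqP xE.
      by have := none q; rewrite xE pq -eE EM.
    by have := none p; rewrite xE adj_sym pq setUC -eE EM.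
  have sadj x : adj x (s x) by case/andP: (sP x).
  have sM x : [set x; s x] \in M by case/andP: (sP x).
  have si : involutive s.
    move=> x; apply: (uM (s x)) => //; first by rewrite adj_sym.
    by rewrite setUC.
  exists s; first by rewrite inE; apply/matching_onP; split=> // x; rewrite inE.
  apply/setP => E; apply/idP/imsetP => [EM|[x _ ->]] //.
  have /imsetP[[p q]] := ME _ EM.
  rewrite inE /= => pq eE; exists p => //; rewrite eE; congr [set _; _].
  by apply: (uM p) => //; rewrite -eE.
rewrite inE => /matching_onP[si sa _] ->; split.
  apply/subsetP => _ /imsetP[x _ ->]; apply/imsetP; exists (x, s x) => //.
  by rewrite inE /= sa // inE.
apply/forallP => x; apply/cards1P; exists [set x; s x].
by apply/setP => E; rewrite !inE in_pairs.
Qed.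

Lemma nmatch0 (G : sgraph) : nmatch (set0 : {set G}) = 1%N.
Proof.
apply/eqP/cards1P; exists [ffun x => x]; apply/setP => s; rewrite !inE.
apply/matching_onP/eqP => [[_ _ h]|->].
  by apply/ffunP => x; rewrite ffunE h ?inE.
by split=> x; rewrite ?inE // !ffunE.
Qed.

Lemma matching_on_closed (G : sgraph) (U : {set G}) (s : {ffun G -> G}) x :
  matching_on U s -> (s x \in U) = (x \in U).
Proof.
case/matching_onP => si sa sN; have half y : y \in U -> s y \in U.
  move=> yU; apply: contraTT (sa y yU) => /sN; rewrite si => <-.
  by rewrite adj_irr.
by apply/idP/idP => /half //; rewrite si.
Qed.

Lemma nmatch_isolated (G : sgraph) (U : {set G}) (l : G) :
  l \in U -> {in U, forall u, ~~ adj l u} -> nmatch U = 0%N.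
Proof.
move=> lU iso; apply: eq_card0 => s; rewrite inE; apply/negP => ms.
have := iso (s l); rewrite (matching_on_closed _ ms) => /(_ lU).
by case/matching_onP: ms => _ sa _; rewrite sa.
Qed.

(** The partner of [l] is forced to be [v]. Making the involution the identity on both vertices
    ([cut]) is undone by exchanging them again ([glue]). *)
Lemma nmatch_leaf (G : sgraph) (U : {set G}) (l v : G) :
  l \in U -> adj l v -> {in U, forall u, adj l u -> u = v} ->
  nmatch U = if v \in U then nmatch (U :\ l :\ v) else 0%N.
Proof.
move=> lU lv leaf; case: ifPn => vU; last first.
  apply: (nmatch_isolated lU) => u uU; apply: contraNN vU => /(leaf u uU) <- //.
have lNv := adj_neq lv.
pose cut (s : {ffun G -> G}) := [ffun x => if (x == l) || (x == v) then x else s x].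
pose glue (s : {ffun G -> G}) :=
  [ffun x => if x == l then v else if x == v then l else s x].
have sl s : matching_on U s -> s l = v /\ s v = l.
  move=> ms; case/matching_onP: (ms) => si sa _.
  have e : s l = v by apply: leaf; rewrite ?(matching_on_closed _ ms) // sa.
  by rewrite -e si.
have cutN s x : matching_on U s -> x != l -> x != v -> (s x != l) && (s x != v).
  move=> ms xl xv; have [hl hv] := sl s ms.
  case/matching_onP: ms => si _ _.
  have -> : (s x == l) = (x == v) by rewrite -[in LHS]hv (inj_eq (inv_inj si)).
  have -> : (s x == v) = (x == l) by rewrite -[in LHS]hl (inj_eq (inv_inj si)).
  by rewrite xl xv.
have injc : {in [set s | matching_on U s] &, injective cut}.
  move=> s t; rewrite !inE => /sl[s1 s2] /sl[t1 t2] /ffunP e.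
  apply/ffunP => x; have := e x; rewrite !ffunE.
  by case: eqVneq => [->|_]; [rewrite s1 t1|case: eqVneq => [->|_]; rewrite ?s2 ?t2].
rewrite /nmatch -(card_in_imset injc); congr #|pred_of_set _|.
apply/setP => t; rewrite inE; apply/imsetP/idP => [[s]|mt].
  rewrite inE => ms ->; have := cutN s _ ms; have [hl hv] := sl s ms.
  case/matching_onP: ms => si sa sN cN.
  apply/matching_onP; split=> x.
  - rewrite !ffunE; case: (eqVneq x l) => [->|xl] /=; first by rewrite eqxx.
    case: (eqVneq x v) => [->|xv] /=; first by rewrite eqxx orbT.
    by case/andP: (cN x xl xv) => /negPf-> /negPf->; rewrite si.
  - by rewrite !inE ffunE => /and3P[/negPf-> /negPf-> /sa].
  - rewrite !inE ffunE; case: (x == l) => //; case: (x == v) => //= /sN //.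
exists (glue t); last first.
  case/matching_onP: mt => _ _ tN.
  apply/ffunP => x; rewrite !ffunE.
  case: eqVneq => [->|_] /=; first by rewrite tN // !inE eqxx andbF.
  by case: eqVneq => [->|_] //=; rewrite tN // !inE eqxx.
have closed := matching_on_closed _ mt; rewrite inE.
case/matching_onP: mt => ti ta tN.
have tl : t l = l by rewrite tN // !inE eqxx andbF.
have tv : t v = v by rewrite tN // !inE eqxx.
apply/matching_onP; split=> x.
- rewrite !ffunE; case: (eqVneq x l) => [->|xl] /=; first by rewrite eq_sym (negPf lNv) eqxx.
  case: (eqVneq x v) => [->|xv] /=; first by rewrite eqxx.
  have -> : (t x == l) = (x == l) by rewrite -[in LHS]tl (inj_eq (inv_inj ti)).
  have -> : (t x == v) = (x == v) by rewrite -[in LHS]tv (inj_eq (inv_inj ti)).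
  by rewrite (negPf xl) (negPf xv) ti.
- move=> xU; rewrite ffunE; case: (eqVneq x l) => [->|xl] //.
  case: (eqVneq x v) => [->|xv]; first by rewrite adj_sym.
  by rewrite ta // !inE xl xv.
- move=> xU; rewrite ffunE; case: (eqVneq x l) xU => [->|xl]; first by rewrite lU.
  by case: (eqVneq x v) => [->|xv xU]; rewrite ?vU // tN // !inE (negPf xU) !andbF.
Qed.

(** * Perfect matchings of a Cartesian product *)

Lemma prod_card (I J : finType) (Q : I -> pred J) :
  (\prod_i #|Q i| = #|family Q|)%N.
Proof.
under eq_bigr do rewrite -sum1_card.
by rewrite bigA_distr_big_dep -sum1_card; apply: eq_bigr => f _; rewrite big1.
Qed.

(** Matched vertices differ in exactly one coordinate. Once it is fixed, as [S v], in which rows the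
    column over v is matched along H, the matchings inside the columns and inside the rows can be
    chosen independently. *)
Lemma Pm_cart (G H : sgraph) :
  Pm (cart_graph G H) =
  (\sum_(S : {ffun H -> {set G}})
     (\prod_v nmatch (~: S v)) * \prod_i nmatch [set v | i \in S v])%N.
Proof.
pose stay (s : {ffun G * H -> G * H}) := [ffun v => [set i | (s (i, v)).1 == i]].
rewrite Pm_nmatch /nmatch -sum1_card (partition_big stay xpredT) //=.
apply: eq_bigr => S _; rewrite sum1dep_card.
rewrite !prod_card -[RHS]cardX.
pose parts (s : {ffun G * H -> G * H}) :=
  ([ffun v => [ffun i => (s (i, v)).1]], [ffun i => [ffun v => (s (i, v)).2]]).
have parts_inj : injective parts.
  move=> s t [/ffunP e1 /ffunP e2]; apply/ffunP => -[i v].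
  have /ffunP/(_ i) := e1 v; have /ffunP/(_ v) := e2 i; rewrite !ffunE.
  by case: (s _) (t _) => [? ?] [? ?] /= -> ->.
rewrite -(card_imset _ parts_inj).
apply: eq_card => -[f g]; apply/imsetP/andP => /= [[s]|[/familyP fS /familyP gS]].
  rewrite !inE => /andP[/matching_onP[si sa _] /eqP/ffunP sS].
  have onS i v : i \in S v -> s (i, v) = (i, (s (i, v)).2) /\ adj v (s (i, v)).2.
    rewrite -sS ffunE inE; have := sa (i, v) (in_setT _).
    case: (s (i, v)) => a b /= + /eqP ai.
    by rewrite ai /cart_adj /= adj_irr eqxx orbF.
  have offS i v : i \notin S v -> s (i, v) = ((s (i, v)).1, v) /\ adj i (s (i, v)).1.
    rewrite -sS ffunE inE eq_sym; have := sa (i, v) (in_setT _).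
    case: (s (i, v)) => a b /= + /negPf ai.
    by rewrite /cart_adj /= ai /= => /andP[-> /eqP->].
  case=> -> ->; split; apply/familyP => x; rewrite !ffunE inE; apply/matching_onP.
    split=> i.
    - rewrite !ffunE; have [/onS[e _]|/offS[e _]] := boolP (i \in S x).
        by rewrite e /= e.
      by rewrite -{1}e si.
    - by rewrite inE ffunE => /offS[].
    - by rewrite inE negbK ffunE => /onS[-> _].
  split=> v.
  - rewrite !ffunE; have [/onS[e _]|/offS[e _]] := boolP (x \in S v).
      by rewrite -{1}e si.
    by rewrite e /= e.
  - by rewrite inE ffunE => /onS[].
  - by rewrite inE ffunE => /offS[-> _].
(* At each vertex one of [f], [g] is the identity, so applying both moves along a single edge of the
   product. *)
pose s := [ffun x : G * H => (f x.2 x.1, g x.1 x.2)].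
have fM v : matching_on (~: S v) (f v) by have := fS v; rewrite inE.
have gM i : matching_on [set v | i \in S v] (g i) by have := gS i; rewrite inE.
have fN i v : i \in S v -> f v i = i.
  by move=> iS; case/matching_onP: (fM v) => _ _ ->; rewrite // inE negbK.
have gN i v : i \notin S v -> g i v = v.
  by move=> iS; case/matching_onP: (gM i) => _ _ ->; rewrite // inE.
have fa i v : i \notin S v -> adj i (f v i).
  by move=> iS; case/matching_onP: (fM v) => _ -> //; rewrite inE.
have ga i v : i \in S v -> adj v (g i v).
  by move=> iS; case/matching_onP: (gM i) => _ -> //; rewrite inE.
exists s; last first.
  by rewrite /parts; congr pair; apply/ffunP => x; rewrite ffunE; apply/ffunP => y;
    rewrite !ffunE.
rewrite !inE; apply/andP; split.
  apply/matching_onP; split=> -[i v]; rewrite ?inE // !ffunE /=.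
    have := matching_on_closed i (fM v); have := matching_on_closed v (gM i).
    rewrite !inE; have [iS|iS] := boolP (i \in S v) => e1 e2.
      by rewrite (fN i v) // (fN i) //; case/matching_onP: (gM i) => ->.
    by rewrite (gN i v) // (gN _ v) //; case/matching_onP: (fM v) => ->.
  move=> _; rewrite /cart_adj /=; have [iS|iS] := boolP (i \in S v).
    by rewrite fN // eqxx ga.
  by rewrite gN // eqxx fa // orbT.
apply/eqP/ffunP => v; rewrite ffunE; apply/setP => i; rewrite inE ffunE /=.
have [iS|iS] := boolP (i \in S v); first by rewrite fN // eqxx.
by apply: contraTF (fa _ _ iS) => /eqP->; rewrite adj_irr.
Qed.

(** * Leaves of a forest and the layered sum *)

(** If every vertex of [W] had two neighbours in [W], simple paths in [W] could be prolonged without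
    end, since running back into the path would close a cycle. *)
Lemma forest_leaf (T : sgraph) (W : {set T}) :
  acyclic T -> W != set0 ->
  exists2 l, l \in W &
    {in W, forall u, ~~ adj l u} \/
    exists v, [/\ v \in W, adj l v & {in W, forall u, adj l u -> u = v}].
Proof.
move=> acyc /set0Pn[x0 x0W]; pose N l := [set u in W | adj l u].
have [/exists_inP[l lW]|] := boolP [exists l in W, #|N l| <= 1]%N.
  rewrite leq_eqVlt ltnS leqn0 => /orP[/cards1P[v Nv]|/eqP/cards0_eq N0].
    have inN u : u \in W -> adj l u -> u \in [set v] by rewrite -Nv inE => ->.
    have: v \in N l by rewrite Nv set11.
    rewrite inE => /andP[vW lv]; exists l => //; right; exists v; split=> //.
    by move=> u uW /(inN u uW); rewrite inE => /eqP.
  exists l => //; left=> u uW; apply/negP => lu.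
  by have := in_set0 u; rewrite -N0 inE uW lu.
rewrite negb_exists_in => /forall_inP deg2; exfalso.
have long n : exists x p,
    [/\ size p = n, path (@adj T) x p, uniq (x :: p) & {subset x :: p <= W}].
  elim: n => [|n [x [p [sp xp up pW]]]].
    by exists x0, [::]; split=> // x; rewrite inE => /eqP->.
  (* The new vertex differs from the successor of [x] on the path, so meeting the path at [w] gives
     a cycle with at least three vertices. *)
  have [w [wW xw wp]] : exists w, [/\ w \in W, adj x w & w != head x p].
    have := deg2 x (pW x (mem_head _ _)); rewrite -ltnNge => /card_gt1P[a [b []]].
    rewrite !inE => /andP[aW xa] /andP[bW xb] ab.
    have [e|] := eqVneq a (head x p); last by exists a.
    by exists b; split; rewrite -?e 1?eq_sym.
  have [wxp|wxp] := boolP (w \in x :: p); last first.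
    exists w, (x :: p); split; [by rewrite /= sp| |by rewrite cons_uniq wxp|].
      by rewrite /= adj_sym xw.
    by move=> u; rewrite inE => /predU1P[->|/pW].
  move: wxp wp; rewrite inE eq_sym (negPf (adj_neq xw)) /=; move: xp up {sp pW}.
  case: p => // y q xp up; rewrite inE /= => /orP[->//|wq] wy.
  case/splitPr: wq xp up => q1 q2; rewrite -cat_rcons.
  rewrite -[y :: _ ++ _]cat_cons -[x :: _ ++ _]cat_cons cat_path cat_uniq.
  case/andP=> xp _ /andP[up _]; have [] := acyc (x :: y :: rcons q1 w).
    by rewrite /= size_rcons.
  rewrite /ucycle up andbT /cycle rcons_path xp /= last_rcons.
  by rewrite adj_sym.
(* A simple path with [#|T|] edges has one vertex too many. *)
have [x [p [sp _ up _]]] := long #|T|.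
by have := max_card (mem (x :: p)); rewrite (card_uniqP up) /= sp ltnn.
Qed.

Definition supported (T I : finType) (W : {set T}) (S : {ffun T -> {set I}}) : bool :=
  [forall v, (v \notin W) ==> (S v == set0)].

(* S v is the set of layers in which v is matched along T; W is the set of
   vertices not yet summed out. *)
Definition layered_sum (R : comNzRingType) (I : finType) (T : sgraph)
    (W : {set T}) (f : T -> {set I} -> R) : R :=
  \sum_(S : {ffun T -> {set I}} | supported W S)
     (\prod_(v in W) f v (S v)) * \prod_i (nmatch [set v | i \in S v])%:R.

Lemma supportedP (T I : finType) (W : {set T}) (S : {ffun T -> {set I}}) :
  reflect (forall v, v \notin W -> S v = set0) (supported W S).
Proof.
by apply: (iffP forallP) => h v; have := h v; [move=> /implyP hv /hv /eqP|
  move=> hv; apply/implyP => /hv ->].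
Qed.

Lemma layered_sum0 (R : comNzRingType) (I : finType) (T : sgraph)
    (f : T -> {set I} -> R) : layered_sum set0 f = 1.
Proof.
rewrite /layered_sum (big_pred1 [ffun => set0]) => [|S]; last first.
  apply/supportedP/eqP => [h|-> v _]; last by rewrite ffunE.
  by apply/ffunP => v; rewrite ffunE h ?inE.
rewrite big_set0 mul1r big1 // => i _.
rewrite (_ : [set v | _] = set0) ?nmatch0 //.
by apply/setP => v; rewrite !inE ffunE inE.
Qed.

(** An isolated vertex cannot be matched along T in any layer, so only the terms with [S l] empty
    survive. *)
Lemma layered_sum_isolated (R : comNzRingType) (I : finType) (T : sgraph)
    (W : {set T}) (f : T -> {set I} -> R) (l : T) :
  l \in W -> {in W, forall u, ~~ adj l u} ->
  layered_sum W f = f l set0 * layered_sum (W :\ l) f.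
Proof.
move=> lW iso; rewrite /layered_sum (bigID (fun S : {ffun T -> {set I}} => S l == set0)) /=.
rewrite [X in _ + X]big1 ?addr0 => [|S /andP[/supportedP supS /set0Pn[i iS]]]; last first.
  rewrite (bigD1 i) //= (nmatch_isolated (l := l)) ?inE // ?mul0r ?mulr0 // => u.
  by rewrite inE => iu; apply: iso; apply: contraTT iu => /supS->; rewrite inE.
rewrite big_distrr; apply: eq_big => [S|S /andP[_ /eqP Sl]].
  apply/andP/supportedP => [[/supportedP supS /eqP Sl] v|supS].
    by rewrite !inE negb_and negbK => /orP[/eqP->|/supS].
  split; last by rewrite supS // !inE eqxx.
  by apply/supportedP => v vW; apply: supS; rewrite !inE negb_and vW orbT.
rewrite (big_setD1 l) //= Sl mulrA; congr (_ * _).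
Qed.

(** Wherever [l] is matched along T its partner is [v]. Hence the layers of [v] split into those
    shared with [l] (the set [A]) and those in which [v] has another partner (the set [B]). *)
Lemma layered_sum_leaf (R : comNzRingType) (I : finType) (T : sgraph)
    (W : {set T}) (f : T -> {set I} -> R) (l v : T) :
  l \in W -> v \in W -> adj l v -> {in W, forall u, adj l u -> u = v} ->
  layered_sum W f =
  layered_sum (W :\ l) (fun u B =>
    if u == v then \sum_(A : {set I} | [disjoint A & B]) f l A * f v (A :|: B)
    else f u B).
Proof.
move=> lW vW lv leaf; have lNv := adj_neq lv; have vNl : v != l by rewrite eq_sym.
pose cut (S : {ffun T -> {set I}}) :=
  ([ffun u => if u == l then set0 else if u == v then S v :\: S l else S u], S l).
pose glue (p : {ffun T -> {set I}} * {set I}) :=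
  [ffun u => if u == l then p.2 else if u == v then p.2 :|: p.1 v else p.1 u].
rewrite /layered_sum (bigID (fun S : {ffun T -> {set I}} => S l \subset S v)) /=.
(* A layer containing [l] but not [v] leaves [l] without a partner, and the term vanishes. *)
rewrite [X in _ + X]big1 ?addr0 => [|S /andP[/supportedP supS /subsetPn[i il iv]]]; last first.
  rewrite (bigD1 i) //= (nmatch_leaf (l := l) (v := v)) ?inE //.
    by rewrite (negPf iv) mul0r mulr0.
  move=> u; rewrite inE => iu; apply: leaf.
  by apply: contraTT iu => /supS->; rewrite inE.
rewrite (reindex_onto glue cut) => [|S /andP[_ /subsetP sub]]; last first.
  apply/ffunP => u; rewrite !ffunE /=; case: eqVneq => [->|ul] //.
  case: eqVneq => [->|uv] //; rewrite (negPf vNl) eqxx.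
  by apply/setP => i; rewrite !inE; have := sub i; case: (i \in S l) => // ->.
have vWl : v \in W :\ l by rewrite !inE vNl.
under [RHS]eq_bigr => S _.
  rewrite (bigD1 v) //= eqxx -mulrA big_distrl /=; over.
rewrite pair_big_dep /=.
apply: eq_big => [[S A]|[S A] /andP[/andP[/supportedP supG _] /eqP[/ffunP eS _]]] /=.
  rewrite !ffunE eqxx (negPf vNl) eqxx /= subsetUl andbT.
  apply/andP/andP => [[/supportedP supS /eqP[/ffunP eS]]|[/supportedP supS disj]].
    have Sl : S l = set0 by rewrite -eS ffunE eqxx.
    have Sv : S v = (A :|: S v) :\: A by rewrite -{1}eS !ffunE (negPf vNl) !eqxx.
    split; last by rewrite Sv disjoints_subset; apply/subsetP => i iA; rewrite !inE iA.
    apply/supportedP => u; rewrite !inE negb_and negbK => /predU1P[->//|uW].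
    have := supS u uW; rewrite ffunE; case: eqVneq uW => [->|_]; first by rewrite lW.
    by case: eqVneq => [->|_ _]; first by rewrite vW.
  have Sl : S l = set0 by apply: supS; rewrite !inE eqxx.
  split.
    apply/supportedP => u uW; rewrite ffunE; case: eqVneq uW => [->|ul uW]; first by rewrite lW.
    case: eqVneq uW => [->|uv uW]; first by rewrite vW.
    by apply: supS; rewrite !inE negb_and uW orbT.
  apply/eqP; congr (_, _); last by rewrite ffunE eqxx.
  apply/ffunP => u; rewrite !ffunE /=.
  rewrite eqxx (negPf vNl) eqxx; case: eqVneq => [->|ul] //; case: eqVneq => [->|uv] //.
  apply/setP => i; rewrite !inE; case: (boolP (i \in A)) => //= iA.
  by rewrite (disjointFr disj iA).
have Sl : S l = set0 by rewrite -eS ffunE eqxx.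
have Sv i : i \in S v -> i \notin A.
  by rewrite -eS !ffunE (negPf vNl) !eqxx inE => /andP[].
rewrite (big_setD1 l) //= (big_setD1 v) //= !ffunE !eqxx (negPf vNl) -!mulrA.
congr (_ * (_ * (_ * _))).
  rewrite [RHS](eq_bigl (mem (W :\ l :\ v))) => [|u]; last by rewrite !inE andbC.
  apply: eq_bigr => u; rewrite !inE => /and3P[/negPf uv /negPf ul _].
  by rewrite !ffunE ul uv.
apply: eq_bigr => i _; congr _%:R; set U := [set u | _].
have inU u : (u \in U) = (i \in if u == l then A else if u == v then A :|: S v else S u).
  by rewrite inE ffunE.
have lU : (l \in U) = (i \in A) by rewrite inU eqxx.
(* In a layer of [A] the pair of [l] and [v] drops out of the matching; any other layer is
   unchanged. *)
have [iA|iA] := boolP (i \in A).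
  rewrite (nmatch_leaf (l := l) (v := v)) ?lU //; last first.
    move=> u; rewrite inU => iu lu; apply: leaf => //; move: iu.
    case: eqVneq lu => [->|ul _]; first by rewrite adj_irr.
    case: eqVneq => [->//|uv]; apply: contraTT => uW.
    by have := supG u uW; rewrite ffunE /= (negPf ul) (negPf uv) => ->; rewrite inE.
  rewrite inU (negPf vNl) eqxx inE iA; congr nmatch; apply/setP => u.
  rewrite !inE ffunE; case: eqVneq => [->|uv] /=; first by apply/esym/negP => /Sv; rewrite iA.
  by case: eqVneq => [->|ul] //=; rewrite Sl inE.
congr nmatch; apply/setP => u; rewrite inU inE.
case: eqVneq => [->|ul]; first by rewrite Sl inE (negPf iA).
by case: eqVneq => [->|uv] //; rewrite inE (negPf iA).
Qed.

(** * Leaf elimination in determinants *)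

(* The determinant of the principal submatrix on W of diag a + i diag b A, padded
   with the identity outside W so that the size does not depend on W. *)
Definition forest_det (C : numClosedFieldType) (T : sgraph)
    (W : {set T}) (a b : T -> C) : C :=
  \det (\matrix_(i < #|T|, j < #|T|)
    let u := enum_val i in let v := enum_val j in
    if (u \in W) && (v \in W) then a u *+ (u == v) + 'i * b u * (adj u v)%:R
    else (u == v)%:R).

Lemma forest_det0 (C : numClosedFieldType) (T : sgraph) (a b : T -> C) :
  forest_det set0 a b = 1.
Proof.
rewrite /forest_det -[RHS](det1 C #|T|); congr (\det _).
by apply/matrixP => i j; rewrite !mxE inE (inj_eq enum_val_inj).
Qed.

Lemma det_unit_col (R : comNzRingType) (n : nat) (A B : 'M[R]_n) (l : 'I_n) :
  (forall i, i != l -> A i l = 0) -> (forall i, i != l -> B i l = 0) ->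
  (forall i j, i != l -> j != l -> A i j = B i j) -> B l l = 1 ->
  \det A = A l l * \det B.
Proof.
move=> A0 B0 AB Bl.
have expand (X : 'M[R]_n) : (forall i, i != l -> X i l = 0) ->
    \det X = X l l * cofactor X l l.
  move=> X0; rewrite (expand_det_col X l) (bigD1 l) //= big1 ?addr0 // => i /X0->.
  by rewrite mul0r.
rewrite (expand A) // (expand B) // Bl mul1r /cofactor.
congr (_ * (_ * \det _)); apply/matrixP => i j; rewrite !mxE.
by rewrite AB // eq_sym neq_lift.
Qed.

Lemma enum_val_eq (T : finType) (i : 'I_#|T|) (x : T) :
  (enum_val i == x) = (i == enum_rank x).
Proof. by rewrite -(inj_eq enum_rank_inj) enum_valK. Qed.

Lemma forest_det_isolated (C : numClosedFieldType) (T : sgraph)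
    (W : {set T}) (a b : T -> C) (l : T) :
  l \in W -> {in W, forall u, ~~ adj l u} ->
  forest_det W a b = a l * forest_det (W :\ l) a b.
Proof.
move=> lW iso; rewrite /forest_det; set B := (X in _ = _ * \det X).
rewrite (@det_unit_col _ _ _ B (enum_rank l)).
- by rewrite mxE enum_rankK lW eqxx adj_irr mulr0 addr0.
- move=> i il; rewrite mxE enum_rankK lW andbT.
  have ul : enum_val i != l by rewrite enum_val_eq.
  case: ifP => [uW|_]; rewrite (negPf ul) // adj_sym (negPf (iso _ uW)) mulr0.
  by rewrite addr0.
- move=> i il; rewrite mxE enum_rankK !inE eqxx andbF.
  by rewrite enum_val_eq (negPf il).
- move=> i j il jl; rewrite !mxE !inE.
  by rewrite !enum_val_eq il jl.
- by rewrite mxE enum_rankK !inE eqxx.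
Qed.

(** Gaussian elimination with pivot [a l]: replacing row v by [a l] times itself minus ['i * b v]
    times row l clears column l, and the square of ['i] turns the minus sign into a plus on the
    diagonal. The scaling costs a factor [a l], which the expansion along column l returns. *)
Lemma forest_det_leaf (C : numClosedFieldType) (T : sgraph)
    (W : {set T}) (a b : T -> C) (l v : T) :
  l \in W -> v \in W -> adj l v -> {in W, forall u, adj l u -> u = v} -> a l != 0 ->
  forest_det W a b =
  forest_det (W :\ l) (fun u => if u == v then a l * a v + b l * b v else a u)
    (fun u => if u == v then a l * b v else b u).
Proof.
move=> lW vW lv leaf al0; apply: (mulfI al0); have lNv := adj_neq lv.
have vNl : v != l by rewrite eq_sym.
rewrite {1}/forest_det; set M := (\matrix_(_, _) _).
pose R := \matrix_(i, j)
  if i == enum_rank v then a l * M i j - 'i * b v * M (enum_rank l) j else M i j.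
pose D := \matrix_(i, j) if i == enum_rank v then M (enum_rank l) j else M i j.
(* By linearity in row v the correction term is a multiple of the determinant of [D], which has two
   equal rows. *)
have -> : a l * \det M = \det R.
  rewrite (@determinant_multilinear _ _ R M D (enum_rank v) (a l) (- ('i * b v))).
  - rewrite (@determinant_alternate _ _ D (enum_rank v) (enum_rank l)) ?mulr0 ?addr0 //.
      by rewrite (inj_eq enum_rank_inj).
    by move=> j; rewrite !mxE eqxx (inj_eq enum_rank_inj) (negPf lNv).
  - by apply/rowP => j; rewrite !mxE eqxx mulNr.
  - by apply/matrixP => i j; rewrite !mxE [lift _ _ == _]eq_sym (negPf (neq_lift _ _)).
  - by apply/matrixP => i j; rewrite !mxE [lift _ _ == _]eq_sym (negPf (neq_lift _ _)).
have adj_l u : u \in W -> adj l u = (u == v).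
  by move=> uW; apply/idP/eqP => [/(leaf u uW)|->].
rewrite /forest_det; set B := (X in _ = _ * \det X).
rewrite (@det_unit_col _ _ _ B (enum_rank l)).
- congr (_ * _).
  by rewrite !mxE enum_rankK -enum_val_eq enum_rankK (negPf lNv) lW eqxx adj_irr mulr0 addr0.
- move=> i; rewrite !mxE -!enum_val_eq !enum_rankK lW eqxx adj_irr => /negPf il.
  rewrite andbT adj_sym il mulr0n add0r mulr0 addr0.
  case: eqVneq => [->|iv].
    rewrite vW adj_l // eqxx /= mulr1n; ring.
  case: ifP => // iW; by rewrite adj_l // (negPf iv) mulr0.
- by move=> i; rewrite -enum_val_eq mxE enum_rankK !inE eqxx andbF => /negPf->.
- move=> i j; rewrite -!enum_val_eq !mxE -!enum_val_eq !enum_rankK !inE => il jl.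
  rewrite il jl lW /=; set u := enum_val i; set w := enum_val j.
  case: eqVneq => [->|uv] //; rewrite vW /=.
  have [wW|wW] := boolP (w \in W); last first.
    have -> : v == w = false by apply: contraNF wW => /eqP<-.
    have -> : l == w = false by apply: contraNF wW => /eqP<-.
    by rewrite !mulr0 subr0.
  rewrite adj_l // [l == w]eq_sym (negPf jl) [w == v]eq_sym; case: eqVneq => [<-|_].
    rewrite adj_irr /= !mulr1n mulr0n; have := sqrCi C; move: 'i => I I2; ring: I2.
  by rewrite /= !mulr0n; ring.
- by rewrite mxE enum_rankK !inE eqxx.
Qed.

(** * Column weights for the path with four vertices *)

(** Coding a set of rows by its membership bits reduces identities between sets of rows to finite
    case analysis. *)
Definition quad (b0 b1 b2 b3 : bool) : {set 'I_4} :=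
  [set i : 'I_4 | nth false [:: b0; b1; b2; b3] i].

Definition bits (A : {set 'I_4}) (T : Type) (f : bool -> bool -> bool -> bool -> T) : T :=
  f (@Ordinal 4 0 isT \in A) (@Ordinal 4 1 isT \in A)
    (@Ordinal 4 2 isT \in A) (@Ordinal 4 3 isT \in A).

Lemma bits_quad b0 b1 b2 b3 (T : Type) (f : bool -> bool -> bool -> bool -> T) :
  bits (quad b0 b1 b2 b3) f = f b0 b1 b2 b3.
Proof. by rewrite /bits !inE. Qed.

Lemma forall_ord4 (P : 'I_4 -> Prop) :
  P (@Ordinal 4 0 isT) -> P (@Ordinal 4 1 isT) -> P (@Ordinal 4 2 isT) ->
  P (@Ordinal 4 3 isT) -> forall i, P i.
Proof.
move=> p0 p1 p2 p3 [[|[|[|[|//]]]] p]; [move: p0|move: p1|move: p2|move: p3];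
  by congr P; apply: val_inj.
Qed.

Lemma quad_bits (A : {set 'I_4}) : A = bits A quad.
Proof. by apply/setP; apply: forall_ord4; rewrite inE. Qed.

Lemma quadU a0 a1 a2 a3 b0 b1 b2 b3 :
  quad a0 a1 a2 a3 :|: quad b0 b1 b2 b3 =
  quad (a0 || b0) (a1 || b1) (a2 || b2) (a3 || b3).
Proof. by apply/setP; apply: forall_ord4; rewrite !inE. Qed.

Lemma quadC a0 a1 a2 a3 :
  ~: quad a0 a1 a2 a3 = quad (~~ a0) (~~ a1) (~~ a2) (~~ a3).
Proof. by apply/setP; apply: forall_ord4; rewrite !inE. Qed.

Lemma quad_disjoint a0 a1 a2 a3 b0 b1 b2 b3 :
  [disjoint quad a0 a1 a2 a3 & quad b0 b1 b2 b3] =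
  ~~ [|| a0 && b0, a1 && b1, a2 && b2 | a3 && b3].
Proof.
rewrite disjoints_subset quadC; apply/subsetP/idP => [sub|].
  have := sub (@Ordinal 4 0 isT); have := sub (@Ordinal 4 1 isT).
  have := sub (@Ordinal 4 2 isT); have := sub (@Ordinal 4 3 isT).
  rewrite !inE /=; move: a0 a1 a2 a3 b0 b1 b2 b3 {sub}.
  by do 4![case=> /=] => b0 b1 b2 b3 h3 h2 h1 h0;
    rewrite ?(negPf (h0 isT)) ?(negPf (h1 isT)) ?(negPf (h2 isT)) ?(negPf (h3 isT)).
rewrite !negb_or => /and4P[h0 h1 h2 h3]; apply: forall_ord4; rewrite !inE /=.
- by move: h0; case: a0.
- by move: h1; case: a1.
- by move: h2; case: a2.
- by move: h3; case: a3.
Qed.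

Lemma sum_quad (R : nmodType) (g : {set 'I_4} -> R) :
  \sum_A g A = \sum_b0 \sum_b1 \sum_b2 \sum_b3 g (quad b0 b1 b2 b3).
Proof.
rewrite !pair_bigA /=.
rewrite (reindex (fun p : bool * bool * bool * bool => quad p.1.1.1 p.1.1.2 p.1.2 p.2)) //=.
exists (fun A => bits A (fun b0 b1 b2 b3 => (b0, b1, b2, b3))).
  by move=> [[[b0 b1] b2] b3] _; rewrite bits_quad.
by move=> A _; rewrite [RHS]quad_bits.
Qed.

(** The first row present is isolated or a leaf attached to the next row, so the count is forced row
    by row; the auxiliary facts treat ever longer end segments. *)
Lemma nmatch_path4 b0 b1 b2 b3 :
  nmatch (quad b0 b1 b2 b3 : {set path_graph 4}) =
  (if b0 == b1 then b2 == b3 else [&& ~~ b0, b2 & ~~ b3]) :> nat.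
Proof.
have n0000 : nmatch (quad false false false false : {set path_graph 4}) = 1%N.
  rewrite -[RHS](nmatch0 (path_graph 4)); congr nmatch.
  by apply/setP; apply: forall_ord4; rewrite !inE.
have n000 b : nmatch (quad false false false b : {set path_graph 4}) = ~~ b :> nat.
  case: b => //=.
  apply: (@nmatch_isolated (path_graph 4) _ (@Ordinal 4 3 isT)); first by rewrite inE.
  by apply: forall_ord4; rewrite !inE.
have n00 b c : nmatch (quad false false b c : {set path_graph 4}) = (b == c) :> nat.
  case: b => //.
  rewrite (@nmatch_leaf (path_graph 4) _ (@Ordinal 4 2 isT) (@Ordinal 4 3 isT)) ?inE //.
    case: c => //=; rewrite -[RHS]n0000; congr nmatch.
    by apply/setP; apply: forall_ord4; rewrite !inE.
  by apply: forall_ord4; rewrite !inE.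
have n0 b c d : nmatch (quad false b c d : {set path_graph 4}) =
    (if b then c && ~~ d else c == d) :> nat.
  case: b => //.
  rewrite (@nmatch_leaf (path_graph 4) _ (@Ordinal 4 1 isT) (@Ordinal 4 2 isT)) ?inE //.
    case: c => //=; rewrite -[RHS]n000; congr nmatch.
    by apply/setP; apply: forall_ord4; rewrite !inE.
  by apply: forall_ord4; rewrite !inE.
case: b0 => //=; last by rewrite n0 eq_sym; case: b1.
rewrite (@nmatch_leaf (path_graph 4) _ (@Ordinal 4 0 isT) (@Ordinal 4 1 isT)) ?inE //.
  case: b1 => //=; rewrite -[RHS]n00; congr nmatch.
  by apply/setP; apply: forall_ord4; rewrite !inE.
by apply: forall_ord4; rewrite !inE.
Qed.

(* With phi the golden ratio, psi is its inverse and phi + psi is sqrt 5.  The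
   coefficients solve the equations that column_state_leaf and
   column_state_path4 impose on a weight bilinear in (a, b) and (a', b');
   sets that are not balanced between even and odd rows never occur. *)
Definition column_state (C : numClosedFieldType) (phi a b a' b' : C) (A : {set 'I_4}) : C :=
  let psi := phi - 1 in
  bits A (fun b0 b1 b2 b3 =>
    match b0, b1, b2, b3 with
    | false, false, false, false => a * a'
    | true, true, true, true => b * b'
    | true, true, false, false | false, false, true, true => (a * b' + a' * b) / (phi + psi)
    | true, false, false, true => (phi * (a * b') - psi * (a' * b)) / (phi + psi)
    | false, true, true, false => (phi * (a' * b) - psi * (a * b')) / (phi + psi)
    | _, _, _, _ => 0
    end).

(** Each pair of parameters is updated exactly as [forest_det_leaf] updates the entries of its
    determinant. *)
Lemma column_state_leaf (C : numClosedFieldType) (phi x y x' y' a b a' b' : C)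
    (B : {set 'I_4}) :
  phi ^+ 2 = phi + 1 -> phi + (phi - 1) != 0 ->
  \sum_(A : {set 'I_4} | [disjoint A & B])
     column_state phi x y x' y' A * column_state phi a b a' b' (A :|: B) =
  column_state phi (x * a + y * b) (x * b) (x' * a' + y' * b') (x' * b') B.
Proof.
move=> phi2 s0; rewrite big_mkcond sum_quad !big_bool (quad_bits B) /bits.
move: (_ \in B) (_ \in B) (_ \in B) (_ \in B) => b0 b1 b2 b3.
rewrite !quad_disjoint !quadU /column_state !bits_quad /=.
move: b0 b1 b2 b3; do 4!case; rewrite /= ?mulr0 ?mul0r ?addr0 ?add0r //;
  by field: phi2.
Qed.

(** * Induction on forests and the factorization into two determinants *)

Lemma forest_ind (T : sgraph) (P : {set T} -> Prop) :
  acyclic T -> P set0 ->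
  (forall (W : {set T}) l, l \in W -> {in W, forall u, ~~ adj l u} -> P (W :\ l) -> P W) ->
  (forall (W : {set T}) l v, l \in W -> v \in W -> adj l v ->
     {in W, forall u, adj l u -> u = v} -> P (W :\ l) -> P W) ->
  forall W, P W.
Proof.
move=> acyc P0 Piso Pleaf W; have [n] := ubnP #|W|; elim: n W => // n IH W Wn.
have [->//|W0] := eqVneq W set0.
have PD l : l \in W -> P (W :\ l).
  by move=> lW; apply: IH; rewrite -ltnS; move: Wn; rewrite (cardsD1 l) lW.
have [l lW [iso|[v [vW lv leaf]]]] := forest_leaf acyc W0.
  exact: Piso iso (PD l lW).
exact: Pleaf leaf (PD l lW).
Qed.

(** A leaf put back receives the colour opposite to that of its only neighbour; an isolated vertex
    may have any colour. *)
Lemma forest_bipartite (T : sgraph) :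
  acyclic T -> exists c : T -> bool, forall u v, adj u v -> c v = ~~ c u.
Proof.
move=> acyc.
suff [c h] : exists c : T -> bool, {in [set: T] &, forall u v, adj u v -> c v = ~~ c u}.
  by exists c => u v; apply: h; rewrite inE.
apply: (forest_ind (P := fun W =>
  exists c : T -> bool, {in W &, forall u v, adj u v -> c v = ~~ c u})).
- exact: acyc.
- by exists xpredT => u v; rewrite inE.
- move=> W l lW iso [c h]; exists c => u v uW vW uv; apply: h => //; rewrite !inE.
    by rewrite uW andbT; apply: contraTneq uv => ->; apply: iso.
  by rewrite vW andbT; apply: contraTneq uv => ->; rewrite adj_sym; apply: iso.
move=> W l w lW wW lw leaf [c h]; exists (fun u => if u == l then ~~ c w else c u).
move=> u v uW vW uv.
case: (eqVneq u l) uv => [->|ul] uv.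
  by rewrite (leaf v vW uv) eq_sym (negPf (adj_neq lw)) negbK.
case: (eqVneq v l) uv => [->|vl] uv; first by rewrite (leaf u) // adj_sym.
by apply: h; rewrite // !inE ?ul ?vl.
Qed.

(** Both sides satisfy the same recursion on leaves and isolated vertices. Positivity survives
    absorption of a leaf and keeps the pivots nonzero. *)
Lemma layered_sum_column_state (C : numClosedFieldType) (T : sgraph) (phi : C)
    (W : {set T}) (a b a' b' : T -> C) :
  acyclic T -> phi ^+ 2 = phi + 1 -> phi + (phi - 1) != 0 ->
  (forall u, [/\ 0 < a u, 0 < b u, 0 < a' u & 0 < b' u]) ->
  layered_sum W (fun u => column_state phi (a u) (b u) (a' u) (b' u)) =
  forest_det W a b * forest_det W a' b'.
Proof.
move=> acyc phi2 s0; move: W a b a' b'.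
apply: (forest_ind (P := fun W => forall a b a' b' : T -> C, _ -> _ = _)) => //.
- by move=> a b a' b' _; rewrite layered_sum0 !forest_det0 mulr1.
- move=> W l lW iso IH a b a' b' pos.
  rewrite (layered_sum_isolated _ lW iso) !(forest_det_isolated _ _ lW iso) IH //.
  rewrite /column_state /bits !inE; ring.
move=> W l v lW vW lv leaf IH a b a' b' pos; have [al _ al' _] := pos l.
rewrite (layered_sum_leaf _ lW vW lv leaf) !(forest_det_leaf _ lW vW lv leaf) ?gt_eqF //.
rewrite -IH; last first.
  move=> u; have [au bu au' bu'] := pos u; have [av bv av' bv'] := pos v.
  have [_ bl _ bl'] := pos l.
  by case: eqP => _; split => //; rewrite ?addr_gt0 ?mulr_gt0.
apply: eq_bigr => S _; congr (_ * _); apply: eq_bigr => u _.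
by case: eqP => // _; rewrite column_state_leaf.
Qed.

(** With psi = phi - 1, the weight of the empty set is phi psi = 1, and the three quotients in
    [column_state] become 1, phi - psi = 1 and 0: the matching counts of the complementary rows. *)
Lemma column_state_path4 (C : numClosedFieldType) (phi : C) (A : {set path_graph 4}) :
  phi ^+ 2 = phi + 1 -> phi + (phi - 1) != 0 ->
  (nmatch (~: A))%:R = column_state phi phi 1 (phi - 1) 1 A.
Proof.
move=> phi2 s0; rewrite (quad_bits A) /bits.
move: (_ \in A) (_ \in A) (_ \in A) (_ \in A) => b0 b1 b2 b3.
rewrite quadC nmatch_path4 /column_state bits_quad.
move: b0 b1 b2 b3; do 4!case; rewrite /= ?mulr1 //; by field: phi2.
Qed.

(** * The spectrum of a tree *)

Lemma horner_char_poly (R : comNzRingType) (n : nat) (A : 'M[R]_n) (x : R) :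
  (char_poly A).[x] = \det (x%:M - A).
Proof.
rewrite -horner_evalE -det_map_mx; congr (\det _).
by apply/matrixP => i j; rewrite !mxE /= /horner_eval hornerD hornerN hornerC hornerMn hornerX.
Qed.

Lemma char_poly_eigenvalues (C : numClosedFieldType) (T : sgraph) :
  char_poly (adj_mx C T) = \prod_(z <- eigenvalues C T) ('X - z%:P).
Proof.
rewrite /eigenvalues; case: closed_field_poly_normal => s /= {1}->.
by rewrite (monicP (char_poly_monic _)) scale1r.
Qed.

Lemma size_eigenvalues (C : numClosedFieldType) (T : sgraph) :
  size (eigenvalues C T) = #|T|.
Proof.
have := size_char_poly (adj_mx C T).
by rewrite char_poly_eigenvalues size_prod_XsubC => -[].
Qed.

(** Since y + iA = -i (iy - A), this is the characteristic polynomial at iy, with one factor -i for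
    each eigenvalue. *)
Lemma forest_detT (C : numClosedFieldType) (T : sgraph) (y : C) :
  forest_det [set: T] (fun=> y) (fun=> 1) =
  \prod_(z <- eigenvalues C T) (y + 'i * z).
Proof.
transitivity (\det (- 'i *: (('i * y)%:M - adj_mx C T))).
  congr (\det _); apply/matrixP => i j; rewrite !mxE /= !inE (inj_eq enum_val_inj).
  have := sqrCi C; move: 'i => I I2; case: (i == j); rewrite ?mulr1n ?mulr0n; ring: I2.
rewrite detZ -horner_char_poly char_poly_eigenvalues horner_prod -{1}(size_eigenvalues C T).
rewrite -iter_mulr_1 -count_predT -big_const_seq -big_split; apply: eq_bigr => z _.
rewrite hornerXsubC /=; have := sqrCi C; move: 'i => I I2; ring: I2.
Qed.

(** The Hermitian argument: for an eigenvector [v] with conjugate [w], evaluating v A w^T from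
    either side gives z and its conjugate times the nonzero sum of squared moduli of the entries. *)
Lemma eigenvalues_real (C : numClosedFieldType) (T : sgraph) (z : C) :
  z \in eigenvalues C T -> z \is Num.real.
Proof.
move=> zs; have : root (char_poly (adj_mx C T)) z.
  by rewrite char_poly_eigenvalues root_prod_XsubC.
rewrite -eigenvalue_root_char => /eigenvalueP[v vA v0].
pose w := map_mx (fun x : C => x^* ) v.
have AT : (adj_mx C T)^T = adj_mx C T by apply/matrixP => i j; rewrite !mxE adj_sym.
have wA : w *m adj_mx C T = z^* *: w.
  apply/rowP => j; have /rowP/(_ j) := vA; rewrite !mxE -rmorphM /= => <-.
  by rewrite rmorph_sum; apply: eq_bigr => k _; rewrite !mxE rmorphM rmorph_nat.
have n0 : (v *m w^T) 0 0 != 0.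
  apply: contraNneq v0 => n0; apply/eqP/rowP => j; rewrite mxE.
  have /eqP := n0; rewrite mxE psumr_eq0 => [/allP/(_ j (mem_index_enum _))|k _].
    by rewrite !mxE mul_conjC_eq0 => /eqP.
  by rewrite !mxE mul_conjC_ge0.
have : v *m adj_mx C T *m w^T = v *m (w *m adj_mx C T)^T.
  by rewrite trmx_mul AT mulmxA.
rewrite vA wA linearZ /= -scalemxAl -scalemxAr => /matrixP/(_ 0 0).
rewrite mxE [X in _ = X]mxE => /(mulIf n0) e; exact/CrealP.
Qed.

(** Conjugating by the diagonal matrix of signs of a 2-colouring turns X - A into X + A, so the
    characteristic polynomial is even or odd according to the parity of [#|T|]. *)
Lemma eigenvalues_opp (C : numClosedFieldType) (T : sgraph) :
  acyclic T -> perm_eq (eigenvalues C T) (map -%R (eigenvalues C T)).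
Proof.
move=> /forest_bipartite[c cadj]; apply: prod_XsubC_eq; rewrite big_map.
set A := adj_mx C T; pose S : 'M[{poly C}]_#|T| := diag_mx (\row_i (-1) ^+ c (enum_val i)).
have S2 : \det S * \det S = 1.
  rewrite det_diag -big_split big1 //= => i _.
  by rewrite !mxE -expr2 sqrr_sign.
have conjS : S *m char_poly_mx A *m S = 'X%:M + map_mx polyC A.
  apply/matrixP => i j; rewrite mul_mx_diag mul_diag_mx !mxE.
  have [<-|ij] := eqVneq i j.
    by rewrite adj_irr subr0 addr0 mulr1n mulrAC -expr2 sqrr_sign mul1r.
  rewrite !mulr0n !add0r.
  have [/cadj e|_] := boolP (adj _ _); last by rewrite polyC0 oppr0 mulr0 mul0r.
  rewrite e; case: (c _); rewrite /= expr0 expr1; ring.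
have detXA : char_poly A = \det ('X%:M + map_mx polyC A).
  by rewrite -conjS !det_mulmx mulrAC S2 mul1r.
have : \det (map_mx (comp_poly (- 'X)) (char_poly_mx A)) = (-1) ^+ #|T| * char_poly A.
  rewrite [in RHS]detXA -detZ; congr (\det _); apply/matrixP => i j.
  rewrite !mxE rmorphB rmorphMn /= comp_polyX comp_polyC; ring.
rewrite det_map_mx -/(char_poly A) char_poly_eigenvalues rmorph_prod.
rewrite -{1}(size_eigenvalues C T) => e; apply: (@mulfI _ ((-1) ^+ size (eigenvalues C T))).
  by rewrite signr_eq0.
rewrite -{}e -iter_mulr_1 -count_predT -big_const_seq -big_split.
apply: eq_bigr => z _; rewrite /= comp_polyB comp_polyX comp_polyC polyCN; ring.
Qed.

(** * Evaluation with the golden ratio *)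

(** The bound makes phi - 1 positive, as the initial parameters of the leaf recursion must be. *)
Lemma golden_ratio (C : numClosedFieldType) :
  exists2 phi : C, phi ^+ 2 = phi + 1 & 1 < phi.
Proof.
exists ((1 + sqrtC 5) / 2).
  by have := sqrtCK (5 : C); move: (sqrtC 5) => r r2; field: r2.
rewrite ltr_pdivlMr ?ltr0n // mul1r -[X in X < _]/(1 + 1) ltrD2l.
by rewrite -[X in X < _]sqrtC1 ltr_sqrtC ?nnegrE ?ler0n ?ler01 ?ltr1n.
Qed.

(** Negative eigenvalues are paired with positive ones of equal multiplicity. The eigenvalue 0 is
    its own opposite, and [g 0 = 1] makes its doubled factor harmless. *)
Lemma prod_eigenvalues_sym (C : numClosedFieldType) (T : sgraph) (g : C -> C) :
  acyclic T -> g 0 = 1 ->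
  \prod_(z <- eigenvalues C T) g z =
  \prod_(z <- eigenvalues C T | 0 <= z) (g z * g (- z)).
Proof.
move=> acyc g0; rewrite (bigID (fun z => 0 <= z)) /= [RHS]big_split; congr (_ * _).
rewrite (perm_big _ (eigenvalues_opp C acyc)) big_map.
rewrite big_seq_cond [RHS]big_seq_cond [RHS](bigID (fun z => z == 0)) /=.
rewrite [X in _ = X * _]big1 ?mul1r => [|z /andP[_ /eqP->]]; last by rewrite oppr0.
apply: eq_bigl => z; rewrite -andbA; apply: andb_id2l => /eigenvalues_real zR.
by rewrite oppr_ge0 -real_ltNge ?real0 // lt_def andbC.
Qed.

Theorem theorem13 (C : numClosedFieldType) (n : nat) (T : sgraph)
    (hn : #|T| = n) (hT : is_tree T) :
  (Pm (cart_graph (path_graph 4) T))%:R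
    = \prod_(alpha <- eigenvalues C T | 0 <= alpha)
        (1 + 3 * alpha ^+ 2 + alpha ^+ 4).
Proof.
have [_ acyc] := hT; have [phi phi2 phi1] := golden_ratio C.
have phi0 : 0 < phi by apply: lt_trans phi1.
have psi0 : 0 < phi - 1 by rewrite subr_gt0.
have s0 : phi + (phi - 1) != 0 by rewrite gt_eqF // addr_gt0.
transitivity (forest_det [set: T] (fun=> phi) (fun=> 1) *
              forest_det [set: T] (fun=> phi - 1) (fun=> 1)).
  rewrite -(layered_sum_column_state _ acyc phi2 s0) // Pm_cart natr_sum.
  rewrite /layered_sum; apply: eq_big => [S|S _].
    by apply/esym/supportedP => v; rewrite inE.
  rewrite natrM !natr_prod; congr (_ * _); apply: eq_big => [v|v _]; first by rewrite inE.
  exact: column_state_path4.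
rewrite !forest_detT -big_split /=.
rewrite (@prod_eigenvalues_sym C T (fun z => (phi + 'i * z) * (phi - 1 + 'i * z)) acyc).
  apply: eq_bigr => z _; have := sqrCi C; move: 'i => I I2; ring: I2 phi2.
(* The factor at z = 0 is phi (phi - 1) = 1. *)
ring: phi2.
Qed.
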